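(* Let $\alpha\in(0,1]$, $C>0$, and let $X$ be a superreflexive Banach space with an equivalent norm $\|\cdot\|$ satisfying $$\lambda\|x\|^{1+\alpha}+(1-\lambda)\|y\|^{1+\alpha}-\|\lambda x+(1-\lambda)y\|^{1+\alpha}\le\lambda(1-\lambda)2^{-\alpha}C\|x-y\|^{1+\alpha}\quad\text{for all }x,y\in X,\ \lambda\in[0,1].$$ Let $\omega$ be a modulus of continuity such that $t\mapsto t^\alpha/\omega(t)$ is non-decreasing on $(0,\infty)$. Let $E\subset X$ be a nonempty subset and $f:E\to\mathbb{R}$, $G:E\to X^*$ two functions. There exists $F\in C^{1,\omega}(X)$ such that $(F,DF)=(f,G)$ on $E$ if and only if $(f,G)$ satisfies condition $(W^{1,\omega})$ on $E$ for some $M>0$, that is, $$f(z)\le f(y)+\tfrac12\langle G(y)+G(z),z-y\rangle+M\varphi(\|y-z\|)-2M\varphi^*\!\left(\frac{\|G(y)-G(z)\|_*}{2M}\right)\quad\text{for all }y,z\in E.$$ Moreover, if $(f,G)$ satisfies $(W^{1,\omega})$ with constant $M>0$, then $F$ can be chosen so that $M_\omega(DF)\le12\left(1+\frac{3^{1+\alpha}}{1+\alpha}C\right)M$.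
   Context: Spaces are real. A modulus of continuity here is a concave, increasing, continuous function $\omega:[0,\infty)\to[0,\infty)$ with $\omega(0)=0$ and $\lim_{t\to\infty}\omega(t)=\infty$; $\varphi(t)=\int_0^t\omega(s)\,ds$ and $\varphi^*(t)=\sup_{s\ge0}\{ts-\varphi(s)\}=\int_0^t\omega^{-1}(s)\,ds$ for $t\ge0$. $\|\cdot\|_*$ is the norm of $X^*$ dual to $\|\cdot\|$, and $\langle\xi,v\rangle=\xi(v)$ for $\xi\in X^*$, $v\in X$. $C^{1,\omega}(X)$ is the set of Fréchet differentiable $g:X\to\mathbb{R}$ for which there is a constant $K>0$ with $\|Dg(x)-Dg(y)\|_*\le K\omega(\|x-y\|)$ for all $x,y\in X$, and $M_\omega(Dg)=\sup_{x\ne y}\frac{\|Dg(x)-Dg(y)\|_*}{\omega(\|x-y\|)}$. *)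

(* Defs.v *)
From HB Require Import structures.
From mathcomp Require Import all_boot all_order all_algebra.
From mathcomp Require Import all_classical all_reals all_analysis.

Set Implicit Arguments.
Unset Strict Implicit.
Unset Printing Implicit Defensive.

Import Order.TTheory GRing.Theory Num.Theory.
Import numFieldNormedType.Exports.

Local Open Scope classical_set_scope.
Local Open Scope ring_scope.

Record dual_space (R : realType) (X : normedModType R) := DualSpace {
  dual_fun :> {linear X -> R^o};
  dual_continuous : continuous dual_fun }.

(* The dual norm induced by a norm [N] on [X]. Since [sup] is [0] on sets that
   are not bounded above, it is meaningful for bounded functionals only. *)
Definition dnorm (R : realType) (X : normedModType R) (N : X -> R)
    (xi : X -> R) : R :=
  sup [set `|xi v| | v in [set v | N v <= 1]].

(* Definiteness of [N] follows from the lower bound. *)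
Definition equivalent_norm (R : realType) (X : normedModType R)
    (N : X -> R) : Prop :=
  [/\ forall x y : X, N (x + y) <= N x + N y,
      forall (a : R) (x : X), N (a *: x) = `|a| * N x &
      exists c1 c2 : R, [/\ 0 < c1, 0 < c2 &
        forall x : X, c1 * `|x| <= N x <= c2 * `|x|]].

(* Every bounded linear form on the dual of [X] is an evaluation. The type
   [dual_space X] carries no module structure, so linearity of [Phi] is expressed
   through the pointwise identity [zeta = a xi + eta]. *)
Definition reflexive_space (R : realType) (X : normedModType R) : Prop :=
  forall Phi : dual_space X -> R,
    (forall (a : R) (xi eta zeta : dual_space X),
       (forall v : X, zeta v = a * xi v + eta v) ->
       Phi zeta = a * Phi xi + Phi eta) ->
    (exists c : R, forall xi : dual_space X,
       `|Phi xi| <= c * dnorm (fun v : X => `|v|) xi) ->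
    exists x : X, forall xi : dual_space X, Phi xi = xi x.

(* [Y] is finitely representable in [X]: every finite-dimensional subspace of
   [Y], here the span of [y_0, ..., y_(n-1)], embeds (1 + eps)-isometrically
   into [X]. Only the restriction of [T] to that subspace matters: [T] need not
   be continuous, and any linear map on a subspace extends linearly to [Y]. *)
Definition finitely_representable (R : realType) (Y X : normedModType R)
    : Prop :=
  forall (n : nat) (y : 'I_n -> Y) (eps : R), 0 < eps ->
    exists T : {linear Y -> X}, forall a : 'I_n -> R,
      let v := \sum_(i < n) a i *: y i in
      (1 - eps) * `|v| <= `|T v| <= (1 + eps) * `|v|.

Definition superreflexive (R : realType) (X : completeNormedModType R) : Prop :=
  forall Y : completeNormedModType R,
    finitely_representable Y X -> reflexive_space Y.

(* Only the values of [omega] on [0, +oo[ are relevant. *)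
Definition modulus_of_continuity (R : realType) (omega : R -> R) : Prop :=
  [/\ [/\ forall t, 0 <= t -> 0 <= omega t,
          omega 0 = 0 &
          forall s t, 0 <= s -> s < t -> omega s < omega t],
      forall s t l, 0 <= s -> 0 <= t -> 0 <= l <= 1 ->
        l * omega s + (1 - l) * omega t <= omega (l * s + (1 - l) * t),
      {within `[0, +oo[, continuous omega} &
      omega t @[t --> +oo] --> +oo].

Definition phi (R : realType) (omega : R -> R) (t : R) : R :=
  \int[lebesgue_measure]_(s in `[0, t]) omega s.

Definition phi_star (R : realType) (omega : R -> R) (t : R) : R :=
  sup [set t * s - phi omega s | s in `[0, +oo[].

Definition C1omega (R : realType) (X : normedModType R) (N : X -> R)
    (omega : R -> R) (g : X -> R^o) : Prop :=
  (forall x : X, differentiable g x) /\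
  exists K : R, 0 < K /\ forall x y : X,
    dnorm N ('d g x \- 'd g y) <= K * omega (N (x - y)).

(* Equal to [-oo] when [X] is trivial. *)
Definition Momega (R : realType) (X : normedModType R) (N : X -> R)
    (omega : R -> R) (g : X -> R^o) : \bar R :=
  ereal_sup [set (dnorm N ('d g (p.1) \- 'd g (p.2)) / omega (N (p.1 - p.2)))%:E
            | p in [set p : X * X | p.1 != p.2]].

Definition W1omega (R : realType) (X : normedModType R) (N : X -> R)
    (omega : R -> R) (E : set X) (f : X -> R) (G : X -> dual_space X) (M : R) : Prop :=
  forall y z : X, E y -> E z ->
    f z <= f y + 2^-1 * (G y (z - y) + G z (z - y))
           + M * phi omega (N (y - z))
           - 2 * M * phi_star omega (dnorm N (G y \- G z) / (2 * M)).

(* [(g, Dg) = (f, G)] on [E]. *)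
Definition extends_jet (R : realType) (X : normedModType R) (E : set X)
    (f : X -> R) (G : X -> dual_space X) (g : X -> R^o) : Prop :=
  forall x : X, E x -> g x = f x /\ forall v : X, 'd g x v = G x v.

(* Main.v *)
Require Import Defs.
From HB Require Import structures.
From mathcomp Require Import all_boot all_order all_algebra.
From mathcomp Require Import all_classical all_reals all_analysis.
From mathcomp Require Import ring lra.

Set Implicit Arguments.
Unset Strict Implicit.
Unset Printing Implicit Defensive.

Import Order.TTheory GRing.Theory Num.Theory.
Import numFieldNormedType.Exports.

Local Open Scope classical_set_scope.
Local Open Scope ring_scope.

(** Suppose that the jet satisfies the condition with constant [M]. An extension
    whose Taylor error at [x] in direction [v] is at most [3 M phi(N v)] has to
    lie, for each point [y] of [E], between the two cones
    [f y + G y (x - y) -+ 3 M phi(N (x - y))]. The condition ensures that every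
    lower cone lies below every upper cone ([W1omega_cones], by Young's
    inequality).

    Call a function paraconvex, or paraconcave, when it satisfies the convexity,
    or concavity, inequality up to [l (1 - l) Psi(x - y)]. The power smoothness of
    [N] and the monotonicity of [t ^ alpha / omega t] make [phi (N _)] paraconcave
    for a multiple of itself: [phi] is a concave function of the power
    [1 + alpha], so it inherits the smoothness of [N ^ (1 + alpha)]
    ([phi_power], [phiN_paraconcave]). Hence all upper cones are paraconcave and
    all lower cones are paraconvex, for the same [Psi = 6 C M phi (N _)].

    The largest paraconvex function [F] below the upper cones plays the role that
    the convex envelope plays for quadratic moduli. It lies above the lower cones,
    and averaging translates shows that it is paraconcave too
    ([paraconvex_sandwich]). Being both, it has at each point a linear tangent map
    with Taylor error at most [Psi] ([para_tangent_map]), and comparing the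
    expansions at two points gives the modulus [24 C M omega] for the derivative
    ([taylor_lipschitz]). This is within the announced bound because
    [2 <= 3 ^ (1 + alpha) / (1 + alpha)]. The cones touch at the points of [E],
    which forces [F = f] and [DF = G] there ([jet_extension]).

    Conversely, the mean value theorem gives the condition with constant [4 K] for
    the jets of a function whose derivative has modulus [K omega]
    ([W1omega_necessary]). *)

(** * A modulus, its primitive and the conjugate of the primitive *)

Section Modulus.
Variables (R : realType) (omega : R -> R).
Hypothesis homega : modulus_of_continuity omega.

Local Notation mu := (@lebesgue_measure R).
Local Notation phi := (phi omega).

Lemma omega_ge0 t : 0 <= t -> 0 <= omega t.
Proof. by case: homega => -[h _ _] _ _ _; apply: h. Qed.

Lemma omega0 : omega 0 = 0.
Proof. by case: homega => -[]. Qed.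

Lemma omega_gt0 t : 0 < t -> 0 < omega t.
Proof. by move=> t0; case: homega => -[_ w0 wlt] _ _ _; rewrite -w0 wlt. Qed.

Lemma omega_le s t : 0 <= s -> s <= t -> omega s <= omega t.
Proof.
move=> s0; rewrite le_eqVlt => /predU1P[-> //|st].
by case: homega => -[_ _ /(_ s t s0 st)/ltW] //.
Qed.

Lemma omega_concave s t l : 0 <= s -> 0 <= t -> 0 <= l <= 1 ->
  l * omega s + (1 - l) * omega t <= omega (l * s + (1 - l) * t).
Proof. by case: homega => _ h _ _; apply: h. Qed.

Lemma omega_continuous t : 0 < t -> {for t, continuous omega}.
Proof.
move=> t0; case: homega => _ _ /continuous_within_itvcyP[+ _] _.
by apply; rewrite in_itv/= t0.
Qed.

Lemma omega_unbounded A : exists2 s, 0 <= s & A <= omega s.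
Proof.
case: homega => _ _ _ /cvgryPge/(_ A) [M [_ hM]].
exists (`|M| + 1); first by rewrite addr_ge0.
by apply: hM => /=; rewrite (le_lt_trans (ler_norm M))// ltrDl.
Qed.

Lemma omega_integrable a b : 0 <= a ->
  mu.-integrable `[a, b] (EFin \o omega).
Proof.
move=> a0; apply: continuous_compact_integrable; first exact: segment_compact.
case: homega => _ _ + _; apply: continuous_subspaceW => x /=.
by rewrite !in_itv/= andbT => /andP[/(le_trans a0)].
Qed.

Lemma phi0 : phi 0 = 0.
Proof. by rewrite /Defs.phi set_itv1 Rintegral_set1. Qed.

(** Monotonicity of [omega] bounds its integral over [[s, t]] by rectangles; all
    that is used of the integral is this two-sided bound and its derivative. *)
Lemma phi_sub s t : 0 <= s -> s <= t ->
  omega s * (t - s) <= phi t - phi s <= omega t * (t - s).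
Proof.
move=> s0 st; rewrite /Defs.phi.
have t0 := le_trans s0 st.
have sub : `]s, t]%classic `<=` `[0, t]%classic.
  move=> x /=; rewrite !in_itv/= => /andP[sx ->].
  by rewrite (le_trans s0 (ltW sx)).
have iw : mu.-integrable `]s, t] (EFin \o omega).
  by apply: (@integrableS _ _ _ mu `[0, t]) => //; exact: omega_integrable.
rewrite Rintegral_itvB ?bnd_simp//; last exact: omega_integrable.
have ic c : mu.-integrable `]s, t] (EFin \o cst c).
  apply: (@integrableS _ _ _ mu `[s, t]) => //.
    by move=> x /=; rewrite !in_itv/= => /andP[/ltW -> ->].
  apply: continuous_compact_integrable; first exact: segment_compact.
  by apply: continuous_subspaceT => x; exact: cvg_cst.
have mE : fine (mu `]s, t]) = t - s.
  rewrite lebesgue_measure_itv /= lte_fin; case: ltP => //= ts.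
  by apply/esym/eqP; rewrite subr_eq0 eq_le ts st.
have cE c : \int[mu]_(_ in `]s, t]) c = c * (t - s).
  by rewrite Rintegral_cst// mE.
rewrite -!cE; apply/andP; split; apply: le_Rintegral => //;
  try exact: ic; move=> x /=; rewrite in_itv/= => /andP[sx xt].
  by rewrite omega_le// ltW.
by rewrite omega_le// (le_trans s0)// ltW.
Qed.

(** Both halves of [phi_sub] say the same thing: [phi] is convex and [omega] is
    its derivative. *)
Lemma phi_tangent s t : 0 <= s -> 0 <= t -> phi s + omega s * (t - s) <= phi t.
Proof.
move=> s0 t0; have [st|/ltW ts] := leP s t.
  by have /andP[h _] := phi_sub s0 st; lra.
by have /andP[_ h] := phi_sub t0 ts; lra.
Qed.

Lemma phi_ge0 t : 0 <= t -> 0 <= phi t.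
Proof.
by move=> t0; have := phi_tangent (lexx 0) t0; rewrite phi0 omega0 mul0r addr0.
Qed.

Lemma phi_le s t : 0 <= s -> s <= t -> phi s <= phi t.
Proof.
move=> s0 st; have := phi_tangent s0 (le_trans s0 st); apply: le_trans.
by rewrite lerDl mulr_ge0 ?omega_ge0 ?subr_ge0.
Qed.

Lemma phi_le_omega t : 0 <= t -> phi t <= t * omega t.
Proof.
by move=> t0; have := phi_tangent t0 (lexx 0); rewrite phi0; lra.
Qed.

Lemma phi_midpoint s t : 0 <= s -> 0 <= t ->
  2 * phi ((s + t) / 2) <= phi s + phi t.
Proof.
move=> s0 t0; have c0 : 0 <= (s + t) / 2 by lra.
by have h1 := phi_tangent c0 s0; have h2 := phi_tangent c0 t0; lra.
Qed.

Lemma phi_is_derive (t : R) : 0 < t -> is_derive t 1 phi (omega t).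
Proof.
move=> t0; have tt : t < t + 1 by rewrite ltrDl.
have [dF FE] := continuous_FTC1_closed tt (omega_integrable (t + 1) (lexx 0))
  t0 (omega_continuous t0).
by split; [exact: dF | rewrite -derive1E; exact: FE].
Qed.

(** The supremum defining [phi_star] is finite since [omega] is unbounded: the
    tangent of [phi] at a point where [omega] exceeds [t] grows at least as fast
    as the line of slope [t]. *)
Lemma young s t : 0 <= s -> t * s <= phi_star omega t + phi s.
Proof.
move=> s0; have [s1 s10 hs1] := omega_unbounded t.
rewrite -lerBlDr; apply: ub_le_sup; last by exists s => //=; rewrite in_itv/= s0.
exists (s1 * omega s1) => _ /= [u + <-]; rewrite in_itv/= andbT => u0.
have h1 := phi_tangent s10 u0; have h2 := phi_ge0 s10.
have h3 : t * u <= omega s1 * u by rewrite ler_wpM2r.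
by lra.
Qed.

Lemma phi_star_le t b : (forall s, 0 <= s -> t * s - phi s <= b) ->
  phi_star omega t <= b.
Proof.
move=> h; apply: ge_sup; first by exists (t * 0 - phi 0), 0; rewrite //= in_itv/= lexx.
by move=> _ /= [s + <-]; rewrite in_itv/= andbT; exact: h.
Qed.

Section Power.
Variable alpha : R.
Hypothesis halpha : 0 < alpha <= 1.
Hypothesis hmono : forall s t : R, 0 < s -> s <= t ->
  s `^ alpha / omega s <= t `^ alpha / omega t.

Lemma omega_power s t : 0 < s -> s <= t -> omega t * s `^ alpha <= omega s * t `^ alpha.
Proof.
move=> s0 st; have t0 := lt_le_trans s0 st.
have := hmono s0 st; rewrite ler_pdivrMr ?omega_gt0//.
by rewrite mulrAC ler_pdivlMr ?omega_gt0// mulrC [X in _ <= X]mulrC.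
Qed.

Lemma power_succ t : 0 <= t -> t `^ (1 + alpha) = t * t `^ alpha.
Proof.
move=> t0; case/andP: halpha => a0 _; rewrite powRD ?powRr1//.
by apply/implyP; rewrite (gt_eqF (addr_gt0 _ a0)).
Qed.

(** The tangent inequality, at [m ^ (1 + alpha)], of the concave function that
    turns [t ^ (1 + alpha)] into [phi t]. That function is concave because its
    derivative is a multiple of [omega t / t ^ alpha], which is non-increasing.
    Here this is read off the sign of the derivative of
    [c * x ^ (1 + alpha) - phi x], negative before [m] and positive after. *)
Lemma phi_power_pos m a : 0 < m -> 0 < a ->
  phi a - phi m <= omega m / ((1 + alpha) * m `^ alpha)
                   * (a `^ (1 + alpha) - m `^ (1 + alpha)).
Proof.
case/andP: halpha => al0 _ m0 a0.
have ma0 : 0 < m `^ alpha by rewrite powR_gt0.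
set c := omega m / _.
pose h (x : R) := c * x `^ (1 + alpha) - phi x.
pose dh (x : R) := c * ((1 + alpha) * x `^ alpha) - omega x.
have hd (x : R) : 0 < x -> is_derive x 1 h (dh x).
  move=> x0; rewrite /h /dh.
  have d1 := @is_derive1_powR R (1 + alpha) x x0.
  have d2 := phi_is_derive x0.
  have -> : x `^ alpha = x `^ (1 + alpha - 1) by congr (_ `^ _); lra.
  by apply: is_deriveB.
have hc x y : 0 < x -> {within `[x, y], continuous h}.
  move=> x0; apply: derivable_within_continuous => z.
  rewrite in_itv/= => /andP[xz _].
  by have := hd z (lt_le_trans x0 xz) => -[].
have dhE x : dh x = (omega m * x `^ alpha - omega x * m `^ alpha) / m `^ alpha.
  by rewrite /dh /c; field; rewrite gt_eqF//=; lra.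
suff : h m <= h a by rewrite /h; lra.
have hdi (x y : R) : 0 < x -> forall z, z \in `]x, y[ -> is_derive z 1 h (dh z).
  by move=> x0 z; rewrite in_itv/= => /andP[/(lt_trans x0) z0 _]; exact: hd.
have [ma|am|->//] := ltgtP m a.
- have [x] := MVT ma (hdi _ _ m0) (hc _ _ m0).
  rewrite in_itv/= => /andP[mx xa] hE; rewrite -subr_ge0 hE mulr_ge0//; last by lra.
  by rewrite dhE; apply: divr_ge0; [rewrite subr_ge0 omega_power// ltW | exact: ltW].
- have [x] := MVT am (hdi _ _ a0) (hc _ _ a0).
  rewrite in_itv/= => /andP[ax xm] hE; rewrite -subr_le0 hE mulr_le0_ge0//; last by lra.
  rewrite dhE; apply: mulr_le0_ge0; last by rewrite invr_ge0 ltW.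
  by rewrite subr_le0 omega_power ?(ltW xm)// (lt_trans a0).
Qed.

(** The value [a = 0] is reached by a limit, the power function being
    differentiable only away from the origin. *)
Lemma phi_power m a : 0 < m -> 0 <= a ->
  phi a - phi m <= omega m / ((1 + alpha) * m `^ alpha)
                   * (a `^ (1 + alpha) - m `^ (1 + alpha)).
Proof.
move=> m0; rewrite le_eqVlt => /predU1P[<-|]; last exact: phi_power_pos.
case/andP: halpha => al0 al1.
have ma0 : 0 < m `^ alpha by rewrite powR_gt0.
set c := omega m / _.
have c0 : 0 <= c by rewrite divr_ge0 ?omega_ge0 ?mulr_ge0 ?ltW// addr_gt0.
have cm0 : 0 <= c * m `^ alpha by rewrite mulr_ge0// ltW.
rewrite (@powR0 _ (1 + alpha)) ?gt_eqF ?addr_gt0// sub0r phi0 sub0r.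
apply/ler_addgt0Pr => e e0.
(* A point so close to the origin that its power weighs less than e. *)
pose b := Num.min m (e / (c * m `^ alpha + 1)).
have b0 : 0 < b by rewrite lt_min m0 divr_gt0// ltr_wpDl.
have bm : b <= m by rewrite ge_min lexx.
have := phi_power_pos m0 b0; rewrite -/c (power_succ (ltW b0)) => h.
have pb := phi_ge0 (ltW b0).
suff : c * (b * b `^ alpha) <= e by lra.
have bb : b `^ alpha <= m `^ alpha.
  apply: ge0_ler_powR => //; rewrite ?nnegrE; exact: ltW.
have : b <= e / (c * m `^ alpha + 1) by rewrite ge_min lexx orbT.
rewrite ler_pdivlMr ?ltr_wpDl// => h2.
have : c * b * b `^ alpha <= c * b * m `^ alpha.
  by rewrite ler_wpM2l// mulr_ge0// ltW.
by lra.
Qed.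

(** The case [a = 0] of [phi_power]. *)
Lemma omega_le_phi_sharp t : 0 <= t -> t * omega t <= (1 + alpha) * phi t.
Proof.
rewrite le_eqVlt => /predU1P[<-|t0]; first by rewrite mul0r phi0 mulr0.
case/andP: halpha => al0 al1.
have ta0 : 0 < t `^ alpha by rewrite powR_gt0.
have := phi_power t0 (lexx 0).
rewrite phi0 (@powR0 _ (1 + alpha)) ?gt_eqF ?addr_gt0// (power_succ (ltW t0)).
have -> : omega t / ((1 + alpha) * t `^ alpha) * (0 - t * t `^ alpha)
    = - (t * omega t / (1 + alpha)).
  by field; rewrite gt_eqF//=; lra.
by rewrite sub0r lerN2 ler_pdivrMr ?addr_gt0//; lra.
Qed.

Lemma omega_le_phi t : 0 <= t -> t * omega t <= 2 * phi t.
Proof.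
move=> t0; case/andP: halpha => al0 al1.
apply: (le_trans (omega_le_phi_sharp t0)).
by apply: ler_wpM2r; [exact: phi_ge0 | lra].
Qed.

(** Linear growth of [omega] makes [phi] at most quadratic: [phi_power] bounds
    the ratio by [2 ^ (1 + alpha) <= 4]. *)
Lemma phi_double t : 0 <= t -> phi (2 * t) <= 4 * phi t.
Proof.
rewrite le_eqVlt => /predU1P[<-|t0]; first by rewrite mulr0 phi0 mulr0.
case/andP: halpha => al0 al1.
have t20 : 0 <= 2 * t by lra.
have ta0 : 0 < t `^ alpha by rewrite powR_gt0.
have := phi_power t0 t20.
rewrite !power_succ ?(ltW t0)// powRM ?(ltW t0)//.
have -> : omega t / ((1 + alpha) * t `^ alpha)
      * (2 * t * (2 `^ alpha * t `^ alpha) - t * t `^ alpha)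
    = t * omega t / (1 + alpha) * (2 * 2 `^ alpha - 1).
  by field; rewrite gt_eqF//=; lra.
have two : 2 `^ alpha <= 2 :> R.
  by rewrite -[leRHS]powRr1// ler_powR// ler1n.
have q0 : 0 <= t * omega t / (1 + alpha).
  by rewrite divr_ge0 ?mulr_ge0 ?omega_ge0 ?ltW// addr_gt0.
have : t * omega t / (1 + alpha) * (2 * 2 `^ alpha - 1)
    <= t * omega t / (1 + alpha) * 3 by apply: ler_wpM2l => //; lra.
have : t * omega t / (1 + alpha) <= phi t.
  by rewrite ler_pdivrMr ?addr_gt0//; have := omega_le_phi_sharp (ltW t0); lra.
by lra.
Qed.

End Power.
End Modulus.

(** * Paraconvex functions and envelopes *)

(** Convexity, up to an error that is controlled by the gauge [Psi] of the
    displacement; the weight [l * (1 - l)] makes the error negligible near the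
    end points, which is what yields derivatives. *)
Definition paraconvex (R : realType) (V : lmodType R) (Psi h : V -> R) :=
  forall x y l, 0 <= l <= 1 ->
    h (l *: x + (1 - l) *: y)
    <= l * h x + (1 - l) * h y + l * (1 - l) * Psi (x - y).

Definition paraconcave (R : realType) (V : lmodType R) (Psi h : V -> R) :=
  forall x y l, 0 <= l <= 1 ->
    l * h x + (1 - l) * h y
    <= h (l *: x + (1 - l) *: y) + l * (1 - l) * Psi (x - y).

Section Envelope.
Variables (R : realType) (V : lmodType R) (Psi : V -> R) (I : Type) (E : set I).
Variables L U : I -> V -> R.
Hypothesis E_nonempty : E !=set0.
Hypothesis L_paraconvex : forall i, E i -> paraconvex Psi (L i).
Hypothesis U_paraconcave : forall i, E i -> paraconcave Psi (U i).
Hypothesis LU : forall i j x, E i -> E j -> L i x <= U j x.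

Let below (h : V -> R) := paraconvex Psi h /\ forall i, E i -> forall x, h x <= U i x.
Let F x := sup [set h x | h in below].

Let F_ge h x : below h -> h x <= F x.
Proof.
move=> hb; apply: ub_le_sup; last by exists h.
by case: E_nonempty => i Ei; exists (U i x) => _ [k [_ kU] <-]; exact: kU.
Qed.

Let F_le x b : (forall h, below h -> h x <= b) -> F x <= b.
Proof.
move=> hb; apply: ge_sup; last by move=> _ [h /hb hx <-].
case: E_nonempty => i Ei; exists (L i x), (L i) => //; split.
  exact: L_paraconvex.
by move=> j Ej y; exact: LU.
Qed.

Let F_below : below F.
Proof.
split=> [x y l l01|i Ei x]; last by apply: F_le => h [_]; exact.
apply: F_le => h hb; apply: le_trans (hb.1 x y l l01) _.
case/andP: (l01) => l0 l1.
by rewrite lerD2r lerD// ler_wpM2l ?subr_ge0 ?F_ge.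
Qed.

Let F_paraconcave : paraconcave Psi F.
Proof.
move=> x y l l01; case/andP: (l01) => l0 l1.
have lK : l + (1 - l) = 1 by ring.
(* The average of two translates of F, lowered by a constant, competes in the
   supremum that defines F. *)
pose h z := l * F (z + (1 - l) *: (x - y)) + (1 - l) * F (z - l *: (x - y))
            - l * (1 - l) * Psi (x - y).
have hb : below h.
  split=> [z w k k01|i Ei z]; rewrite /h.
    have kK : k + (1 - k) = 1 by ring.
    have e (c : V) : k *: z + (1 - k) *: w + c = k *: (z + c) + (1 - k) *: (w + c).
      by rewrite !scalerDr addrACA -scalerDl kK scale1r.
    have d (c : V) : z + c - (w + c) = z - w by rewrite opprD addrACA subrr addr0.
    have := F_below.1 (z + (1 - l) *: (x - y)) (w + (1 - l) *: (x - y)) k k01.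
    have := F_below.1 (z - l *: (x - y)) (w - l *: (x - y)) k k01.
    rewrite -!e !d => /(ler_wpM2l (_ : 0 <= 1 - l)); rewrite subr_ge0 => /(_ l1) h1.
    move=> /(ler_wpM2l l0) h2; lra.
  have := U_paraconcave Ei (z + (1 - l) *: (x - y)) (z - l *: (x - y)) l01.
  have -> : l *: (z + (1 - l) *: (x - y)) + (1 - l) *: (z - l *: (x - y)) = z.
    move: (x - y) => u.
    rewrite !scalerDr scalerN !scalerA (mulrC l) addrACA subrr addr0.
    by rewrite -scalerDl lK scale1r.
  have -> : z + (1 - l) *: (x - y) - (z - l *: (x - y)) = x - y.
    move: (x - y) => u.
    by rewrite opprD opprK addrACA subrr add0r -scalerDl subrK scale1r.
  have := F_below.2 i Ei (z + (1 - l) *: (x - y)).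
  have := F_below.2 i Ei (z - l *: (x - y)).
  move=> /(ler_wpM2l (_ : 0 <= 1 - l)); rewrite subr_ge0 => /(_ l1) h1.
  by move=> /(ler_wpM2l l0) h2 h3; lra.
have := F_ge (l *: x + (1 - l) *: y) hb; rewrite /h.
have -> : l *: x + (1 - l) *: y + (1 - l) *: (x - y) = x.
  by rewrite -addrA -scalerDr (addrC y) subrK -scalerDl lK scale1r.
have -> : l *: x + (1 - l) *: y - l *: (x - y) = y.
  by rewrite scalerBr opprB addrC addrA subrK -scalerDl lK scale1r.
by lra.
Qed.

(** Between paraconvex functions and paraconcave functions above them there is a
    function that is both: the largest paraconvex function below all the upper
    ones. It inherits paraconcavity because the average of two of its translates,
    minus the error allowed to the upper functions, is again paraconvex and
    below them, hence below the largest one. *)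
Lemma paraconvex_sandwich : exists G : V -> R,
  [/\ paraconvex Psi G, paraconcave Psi G &
      forall i, E i -> forall x, L i x <= G x <= U i x].
Proof.
exists F; split=> //; first by case: F_below.
move=> i Ei x; rewrite F_below.2// andbT; apply: F_ge; split.
  exact: L_paraconvex.
by move=> j Ej y; exact: LU.
Qed.

End Envelope.

(** * Tangent maps of functions that are paraconvex and paraconcave *)

Section TangentMap.
Variables (R : realType) (X : normedModType R) (Psi F : X -> R).
Hypothesis Psi_ge0 : forall v, 0 <= Psi v.
Hypothesis Psi_small : forall v e, 0 < e ->
  \forall t \near 0^'+, Psi (t *: v) <= e * t.
Hypothesis F_paraconvex : paraconvex Psi F.
Hypothesis F_paraconcave : paraconcave Psi F.
Variable x : X.

Let H v := F (x + v) - F x.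

(* Along a ray the difference quotients form a Cauchy family as the parameter
   tends to 0, with an error that does not depend on the smaller parameter. *)
Let H_scale s t v : 0 < s -> s <= t ->
  `|H (s *: v) - s / t * H (t *: v)| <= s / t * Psi (t *: v).
Proof.
move=> s0 st; have t0 := lt_le_trans s0 st.
set l := s / t.
have l0 : 0 <= l by rewrite divr_ge0 ?ltW.
have l1 : l <= 1 by rewrite ler_pdivrMr// mul1r.
have l01 : 0 <= l <= 1 by rewrite l0.
have lK : l + (1 - l) = 1 by ring.
have := F_paraconvex (x + t *: v) x l01; have := F_paraconcave (x + t *: v) x l01.
rewrite addrAC subrr add0r.
have -> : l *: (x + t *: v) + (1 - l) *: x = x + s *: v.
  by rewrite scalerDr scalerA divfK ?gt_eqF// addrAC -scalerDl lK scale1r.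
have : l * (1 - l) * Psi (t *: v) <= l * Psi (t *: v).
  by rewrite ler_wpM2r// ler_piMr//; lra.
by rewrite /H ler_norml => h1 h2 h3; apply/andP; split; lra.
Qed.

Let H_quot s t v : 0 < s -> 0 < t ->
  H (s *: v) / s - Psi (s *: v) / s <= H (t *: v) / t + Psi (t *: v) / t.
Proof.
move=> s0 t0; have Ps := Psi_ge0 (s *: v); have Pt := Psi_ge0 (t *: v).
have Qs : 0 <= Psi (s *: v) / s by rewrite divr_ge0 // ltW.
have Qt : 0 <= Psi (t *: v) / t by rewrite divr_ge0 // ltW.
have [st|/ltW ts] := leP s t.
  have := H_scale v s0 st; rewrite ler_norml => /andP[_].
  rewrite -(ler_pM2r (_ : 0 < s^-1)) ?invr_gt0//.
  have -> : (H (s *: v) - s / t * H (t *: v)) / s = H (s *: v) / s - H (t *: v) / t.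
    by field; rewrite !gt_eqF.
  have -> : s / t * Psi (t *: v) / s = Psi (t *: v) / t by field; rewrite !gt_eqF.
  by lra.
have := H_scale v t0 ts; rewrite ler_norml => /andP[+ _].
rewrite -(ler_pM2r (_ : 0 < t^-1)) ?invr_gt0//.
have -> : (H (t *: v) - t / s * H (s *: v)) / t = H (t *: v) / t - H (s *: v) / s.
  by field; rewrite !gt_eqF.
have -> : - (t / s * Psi (s *: v)) / t = - (Psi (s *: v) / s) by field; rewrite !gt_eqF.
by lra.
Qed.

(* The limit of the difference quotients, caught as the cut between their lower
   and upper estimates. *)
Let D v := inf [set H (t *: v) / t + Psi (t *: v) / t | t in [set t | 0 < t]].

Let D_taylor t v : 0 < t -> `|H (t *: v) - t * D v| <= Psi (t *: v).
Proof.
move=> t0.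
have h1 : D v <= H (t *: v) / t + Psi (t *: v) / t.
  apply: ge_inf; last by exists t.
  exists (H (t *: v) / t - Psi (t *: v) / t) => _ [s s0 <-].
  exact: H_quot.
have h2 : H (t *: v) / t - Psi (t *: v) / t <= D v.
  apply: lb_le_inf; first by exists (H (t *: v) / t + Psi (t *: v) / t), t.
  by move=> _ [s s0 <-]; exact: H_quot.
move: h1 h2; rewrite -mulrDl -mulrBl ler_pdivlMr// ler_pdivrMr// => h1 h2.
by rewrite ler_norml; apply/andP; split; lra.
Qed.

Let eq0_small (a : R) : (forall e, 0 < e -> \forall t \near 0^'+, t * `|a| <= e * t) ->
  a = 0.
Proof.
move=> h; apply/eqP; rewrite -normr_le0; apply/ler_addgt0Pr => e e0; rewrite add0r.
near (0 : R)^'+ => t.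
have t0 : 0 < t by near: t; exact: nbhs_right_gt.
rewrite -(ler_pM2l t0) [leRHS]mulrC; near: t; exact: h.
Unshelve. all: by end_near. Qed.

(* Midpoint paraconvexity and paraconcavity at [x + 2 t v] and [x + 2 t w]
   compare the increment along [v + w] with the half sum of two increments. *)
Let D_add v w : D (v + w) = D v + D w.
Proof.
apply/eqP; rewrite -subr_eq0; apply/eqP/eq0_small => e e0.
have e4 : 0 < e / 4 by lra.
near=> t.
have t0 : 0 < t by near: t; exact: nbhs_right_gt.
have t20 : 0 < t * 2 by lra.
have P1 : Psi (t *: (2 *: v)) <= e / 4 * t by near: t; exact: Psi_small.
have P2 : Psi (t *: (2 *: w)) <= e / 4 * t by near: t; exact: Psi_small.
have P3 : Psi (t *: (v + w)) <= e / 4 * t by near: t; exact: Psi_small.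
have P4 : Psi (t *: (2 *: (v - w))) <= e / 4 * t by near: t; exact: Psi_small.
have := D_taylor (v + w) t0.
have := D_taylor v t20; have := D_taylor w t20; rewrite -!scalerA.
have h01 : 0 <= (2^-1 : R) <= 1 by lra.
have := F_paraconvex (x + t *: (2 *: v)) (x + t *: (2 *: w)) h01.
have := F_paraconcave (x + t *: (2 *: v)) (x + t *: (2 *: w)) h01.
have -> : x + t *: (2 *: v) - (x + t *: (2 *: w)) = t *: (2 *: (v - w)).
  by rewrite opprD addrACA subrr add0r !scalerBr.
have h2 : 1 - 2^-1 = 2^-1 :> R by lra.
have -> : 2^-1 *: (x + t *: (2 *: v)) + (1 - 2^-1) *: (x + t *: (2 *: w))
    = x + t *: (v + w).
  rewrite !scalerDr addrACA -scalerDl [2^-1 + _]addrC subrK scale1r h2 !scalerA.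
  by have -> : 2^-1 * t * 2 = t by field.
rewrite /H !ler_norml => q1 q2 /andP[q3 q4] /andP[q5 q6] /andP[q7 q8].
rewrite -[t in t * _]gtr0_norm// -normrM ler_norml; apply/andP; split; lra.
Unshelve. all: by end_near. Qed.

Let D_scale_pos a v : 0 < a -> D (a *: v) = a * D v.
Proof.
move=> a0; apply/eqP; rewrite -subr_eq0; apply/eqP/eq0_small => e e0.
have e2 : 0 < e / 2 by lra.
near=> t.
have t0 : 0 < t by near: t; exact: nbhs_right_gt.
have P1 : Psi (t *: (a *: v)) <= e / 2 * t by near: t; exact: Psi_small.
have := D_taylor (a *: v) t0; have := D_taylor v (mulr_gt0 t0 a0).
rewrite -scalerA !ler_norml => /andP[q3 q4] /andP[q5 q6].
by rewrite -[t in t * _]gtr0_norm// -normrM ler_norml; apply/andP; split; lra.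
Unshelve. all: by end_near. Qed.

Let D_linear : linear (D : X -> R^o).
Proof.
have D0 : D 0 = 0 by have := D_add 0 0; rewrite addr0; lra.
have DN v : D (- v) = - D v by have := D_add v (- v); rewrite subrr D0; lra.
move=> a v w; rewrite D_add; congr (_ + _).
have [a0|a0|->] := ltgtP a 0.
- by rewrite -[a *: v]opprK -scaleNr DN D_scale_pos ?oppr_gt0// mulNr opprK.
- exact: D_scale_pos.
- by rewrite !scale0r D0.
Qed.

(** A function that is both paraconvex and paraconcave has a linear tangent map,
    with Taylor error at most the gauge. Continuity of that map is not claimed:
    it needs in addition that [F] be locally bounded. *)
Lemma para_tangent_map : exists T : {linear X -> R^o},
  forall v, `|F (x + v) - F x - T v| <= Psi v.
Proof.
pose DL : {linear X -> R^o} := HB.pack D (GRing.isLinear.Build R X R^o _ D D_linear).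
exists DL => v; by have := D_taylor v ltr01; rewrite scale1r mul1r.
Qed.

End TangentMap.

(** * The gauge [phi (N _)] for an equivalent norm *)

Section EquivalentNorm.
Variables (R : realType) (X : normedModType R) (N : X -> R).
Hypothesis hN : equivalent_norm N.

Lemma eqnormD v w : N (v + w) <= N v + N w.
Proof. by case: hN. Qed.

Lemma eqnormZ a v : N (a *: v) = `|a| * N v.
Proof. by case: hN. Qed.

Lemma eqnorm0 : N 0 = 0.
Proof. by rewrite -(scale0r (0 : X)) eqnormZ normr0 mul0r. Qed.

Lemma eqnormN v : N (- v) = N v.
Proof. by rewrite -scaleN1r eqnormZ normrN1 mul1r. Qed.

Lemma eqnorm_distC v w : N (v - w) = N (w - v).
Proof. by rewrite -eqnormN opprB. Qed.

Lemma eqnorm_ge0 v : 0 <= N v.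
Proof.
case: hN => _ _ [c1] [c2] [c10 _ /(_ v)/andP[+ _]]; apply: le_trans.
by rewrite mulr_ge0// ltW.
Qed.

Lemma eqnorm_gt0 v : v != 0 -> 0 < N v.
Proof.
move=> v0; case: hN => _ _ [c1] [c2] [c10 _ /(_ v)/andP[+ _]]; apply: lt_le_trans.
by rewrite mulr_gt0// normr_gt0.
Qed.

Lemma eqnorm_le : exists2 c, 0 < c & forall v, N v <= c * `|v|.
Proof. by case: hN => _ _ [c1] [c2] [_ c20 h]; exists c2 => // v; case/andP: (h v). Qed.

Lemma eqnorm_ge : exists2 c, 0 < c & forall v, `|v| <= c * N v.
Proof.
case: hN => _ _ [c1] [c2] [c10 _ h]; exists c1^-1; first by rewrite invr_gt0.
by move=> v; rewrite ler_pdivlMl//; case/andP: (h v).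
Qed.

Lemma continuous_linear_bound (T : {linear X -> R^o}) : continuous T ->
  exists2 k, 0 <= k & forall v, `|T v| <= k * `|v|.
Proof.
move=> Tc; have /linear_boundedP : bounded_near T (nbhs (0 : X)).
  by apply: continuous_linear_bounded; exact: Tc.
case/pinfty_ex_gt0 => k k0 h; exists k => //; exact: ltW.
Qed.

Lemma dnorm_le (xi : X -> R) b : (forall v, N v <= 1 -> `|xi v| <= b) ->
  dnorm N xi <= b.
Proof.
move=> h; apply: ge_sup; last by move=> _ [v /h hv <-].
by exists `|xi 0|, 0 => //=; rewrite eqnorm0.
Qed.

(** Continuity of both maps guarantees that the supremum defining the dual norm
    is finite. *)
Lemma dnorm_ge (S T : {linear X -> R^o}) v : continuous S -> continuous T ->
  `|S v - T v| <= dnorm N (S \- T) * N v.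
Proof.
move=> Sc Tc.
have [->|v0] := eqVneq v 0; first by rewrite eqnorm0 mulr0 !linear0 addr0 normr0.
have Nv := eqnorm_gt0 v0; rewrite -ler_pdivrMr//.
have -> : `|S v - T v| / N v = `|(S \- T) ((N v)^-1 *: v)|.
  have dE (L : {linear X -> R^o}) a : L (a *: v) = a * L v by rewrite linearZ.
  rewrite /= !dE -mulrBr normrM mulrC; congr (_ * _).
  by rewrite ger0_norm// invr_ge0 ltW.
apply: ub_le_sup; last first.
  exists ((N v)^-1 *: v) => //=.
  have Ni : 0 <= (N v)^-1 by rewrite invr_ge0 ltW.
  by rewrite eqnormZ ger0_norm// mulVf// gt_eqF.
have [k k0 hk] := continuous_linear_bound Sc.
have [l l0 hl] := continuous_linear_bound Tc.
have [c c0 hc] := eqnorm_ge.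
exists ((k + l) * c) => _ [w /= w1 <-].
apply: (le_trans (ler_normB _ _)); rewrite mulrDl lerD//.
  apply: (le_trans (hk _)); rewrite ler_wpM2l// (le_trans (hc _))//.
  by rewrite ler_piMr// ltW.
apply: (le_trans (hl _)); rewrite ler_wpM2l// (le_trans (hc _))//.
by rewrite ler_piMr// ltW.
Qed.

Section Smoothness.
Variables (omega : R -> R) (homega : modulus_of_continuity omega).
Local Notation phi := (phi omega).

Lemma phiN_ge0 v : 0 <= phi (N v).
Proof. exact/phi_ge0/eqnorm_ge0. Qed.

Lemma phiN_small e : 0 < e ->
  exists2 d, 0 < d & forall v, N v <= d -> phi (N v) <= e * N v.
Proof.
move=> e0; have := homega => -[_ _ /continuous_within_itvcyP[_] + _].
rewrite (omega0 homega) => /cvgr0_norm_le /(_ e e0) he.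
near (0 : R)^'+ => d.
have d0 : 0 < d by near: d; exact: nbhs_right_gt.
exists d => // v vd; apply: (le_trans (phi_le_omega homega (eqnorm_ge0 v))).
rewrite mulrC ler_wpM2r ?eqnorm_ge0// (le_trans (omega_le homega (eqnorm_ge0 v) vd))//.
apply: le_trans (ler_norm _) _; near: d; exact: he.
Unshelve. all: by end_near. Qed.

Lemma differentiable_taylor (F : X -> R^o) (T : {linear X -> R^o}) A x :
  0 <= A -> continuous T ->
  (forall v, `|F (x + v) - F x - T v| <= A * phi (N v)) ->
  differentiable F x /\ ('d F x = T :> (X -> R^o)).
Proof.
move=> A0 Tc h.
have expand : F \o shift x = cst (F x) + T +o_ 0 id.
  apply/eqaddoP => e /= e0; have [c c0 hc] := eqnorm_le.
  have e'0 : 0 < e / (A * c + 1) by rewrite divr_gt0// ltr_wpDl// mulr_ge0// ltW.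
  have [d d0 hd] := phiN_small e'0.
  apply/nbhs_norm0P; exists (d / c); first by rewrite /= divr_gt0.
  move=> v /= vd.
  have -> : (F \o shift x - (cst (F x) + T)) v = F (x + v) - F x - T v.
    by rewrite !fctE/= opprD addrA (addrC v).
  apply: (le_trans (h v)).
  have Nv : N v <= d.
    by rewrite (le_trans (hc v))// mulrC -ler_pdivlMr// ltW.
  apply: (le_trans (ler_wpM2l A0 (hd v Nv))).
  have : A * (e / (A * c + 1) * N v) <= A * (e / (A * c + 1) * (c * `|v|)).
    by rewrite ler_wpM2l// ler_wpM2l// ltW.
  move=> /le_trans; apply.
  have -> : A * (e / (A * c + 1) * (c * `|v|)) = e * `|v| * (A * c / (A * c + 1)).
    by field; rewrite gt_eqF// ltr_wpDl// mulr_ge0// ltW.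
  have Ac0 : 0 < A * c + 1 by rewrite ltr_wpDl// mulr_ge0// ltW.
  apply: ler_piMr; first by rewrite mulr_ge0// ltW.
  by rewrite ler_pdivrMr// mul1r lerDl.
have dE : 'd F x = T :> (X -> R^o) by exact: diff_unique.
by split=> //; apply/diff_locallyP; rewrite dE.
Qed.

(** A uniform Taylor bound controls the variation of the derivative. With [w] of
    norm at most half of [d = N (x - y)], the two points at [w] and [- w] from
    the midpoint of [x] and [y] are within [d] of both [x] and [y]; expanding [F]
    at [x] and at [y] in these two points gives
    [2 (DF(x) - DF(y)) w <= 4 A phi(d)], and [phi d <= d * omega d]. *)
Lemma taylor_lipschitz (F : X -> R^o) A : 0 <= A ->
  (forall x v, `|F (x + v) - F x - 'd F x v| <= A * phi (N v)) ->
  forall x y, dnorm N ('d F x \- 'd F y) <= 4 * A * omega (N (x - y)).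
Proof.
move=> A0 h x y; apply: dnorm_le => v v1 /=.
have [->|xy] := eqVneq x y.
  by rewrite !subrr normr0 eqnorm0 (omega0 homega) mulr0.
set d := N (x - y); have d0 : 0 < d by rewrite eqnorm_gt0// subr_eq0.
pose w := (d / 2) *: v; pose u := 2^-1 *: (x - y).
have Nw : N w <= d / 2.
  have d2 : 0 <= d / 2 by rewrite divr_ge0// ltW.
  by rewrite eqnormZ ger0_norm// ler_piMr.
have Nu : N u = d / 2 by rewrite eqnormZ ger0_norm ?invr_ge0// mulrC.
have small z : N z <= d / 2 + d / 2 -> A * phi (N z) <= A * phi d.
  move=> zd; apply: ler_wpM2l => //; apply: phi_le => //; first exact: eqnorm_ge0.
  by apply: le_trans zd _; lra.
have uy : y + u = x - u.
  apply: (addIr u); rewrite subrK -addrA -scalerDl.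
  have -> : 2^-1 + 2^-1 = 1 :> R by lra.
  by rewrite scale1r addrC subrK.
have t1 := h x (w - u); have t2 := h x (- w - u).
have t3 := h y (w + u); have t4 := h y (- w + u).
have n1 := small (w - u) (le_trans (eqnormD _ _) _).
have n2 := small (- w - u) (le_trans (eqnormD _ _) _).
have n3 := small (w + u) (le_trans (eqnormD _ _) _).
have n4 := small (- w + u) (le_trans (eqnormD _ _) _).
rewrite !eqnormN Nu !lerD2r in n1 n2 n3 n4.
move: {n1 n2 n3 n4} (n1 Nw) (n2 Nw) (n3 Nw) (n4 Nw) t1 t2 t3 t4.
have -> : x + (w - u) = w + (x - u) by rewrite addrCA.
have -> : x + (- w - u) = - w + (x - u) by rewrite addrCA.
have -> : y + (w + u) = w + (x - u) by rewrite addrCA uy.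
have -> : y + (- w + u) = - w + (x - u) by rewrite addrCA uy.
rewrite !linearB !linearD !linearN /=.
have dw (S : {linear X -> R^o}) : S w = d / 2 * S v by rewrite /w linearZ.
rewrite !dw => n1 n2 n3 n4.
rewrite !ler_norml => /andP[? ?] /andP[? ?] /andP[? ?] /andP[? ?].
have := phi_le_omega homega (ltW d0) => /(ler_wpM2l A0) pd.
by apply/andP; split; rewrite -(ler_pM2l d0); lra.
Qed.

Section PowerSmooth.
Variables alpha C : R.
Hypothesis halpha : 0 < alpha <= 1.
Hypothesis hC : 0 < C.
Hypothesis hsmooth : forall (x y : X) (l : R), 0 <= l <= 1 ->
  l * N x `^ (1 + alpha) + (1 - l) * N y `^ (1 + alpha)
    - N (l *: x + (1 - l) *: y) `^ (1 + alpha)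
  <= l * (1 - l) * 2 `^ (- alpha) * C * N (x - y) `^ (1 + alpha).
Hypothesis hmono : forall s t : R, 0 < s -> s <= t ->
  s `^ alpha / omega s <= t `^ alpha / omega t.

(** Smoothness at the pair [u, - u], whose midpoint is 0. *)
Lemma smoothness_constant_ge2 (u : X) : u != 0 -> 2 <= C.
Proof.
move=> u0; have Nu := eqnorm_gt0 u0; case/andP: halpha => al0 al1.
have h01 : 0 <= (2^-1 : R) <= 1 by lra.
have := hsmooth u (- u) h01.
have h2 : 1 - 2^-1 = 2^-1 :> R by lra.
rewrite h2 scalerN subrr opprK -(mulr2n u) -(scaler_nat 2 u) eqnormZ eqnormN eqnorm0.
rewrite (@powR0 _ (1 + alpha)) ?gt_eqF ?addr_gt0// subr0 normr_nat powRM ?(ltW Nu)//.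
rewrite (power_succ halpha (_ : 0 <= 2))//.
have p0 : 0 < N u `^ (1 + alpha) by rewrite powR_gt0.
have q0 : 0 < 2 `^ alpha :> R by rewrite powR_gt0.
rewrite powRN.
have -> : 2^-1 * 2^-1 * (2 `^ alpha)^-1 * C * (2 * 2 `^ alpha * N u `^ (1 + alpha))
   = C / 2 * N u `^ (1 + alpha) by field; rewrite gt_eqF.
rewrite -mulrDl ler_pM2r//; lra.
Qed.

(** Smoothness of [N ^ (1 + alpha)] passes to [phi (N _)] through the concave
    function behind [phi_power], whose slope at [m = N z], with [z] the convex
    combination, is of order [omega m / m ^ alpha]. This slope is under control
    as long as [m] is at least half of [d = N (x - y)]. When [m] is smaller, the
    triangle inequality bounds [N x] and [N y] by [m + (1 - l) d] and
    [m + l d], and the plain tangent inequality of [phi] suffices because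
    [2 <= C]. *)
Lemma phiN_paraconcave :
  paraconcave (fun v => 2 * C * phi (N v)) (fun v => phi (N v)).
Proof.
move=> x y l l01; case/andP: (l01) => l0 l1; case/andP: halpha => al0 al1.
have ll0 : 0 <= l * (1 - l) by rewrite mulr_ge0 ?subr_ge0.
have [->|xy] := eqVneq x y.
  have -> : l *: y + (1 - l) *: y = y by rewrite -scalerDl addrC subrK scale1r.
  have : 0 <= l * (1 - l) * (2 * C * phi (N (y - y))).
    by rewrite mulr_ge0// mulr_ge0 ?phiN_ge0// mulr_ge0// ltW.
  lra.
have C2 : 2 <= C by apply: (@smoothness_constant_ge2 (x - y)); rewrite subr_eq0.
have d0 : 0 < N (x - y) by rewrite eqnorm_gt0// subr_eq0.
set z := l *: x + (1 - l) *: y; set d := N (x - y) in d0 *.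
have m0 := eqnorm_ge0 z.
have dphi := omega_le_phi homega halpha hmono (ltW d0).
have pd := phi_ge0 homega (ltW d0).
have [dm|/ltW md] := leP (d / 2) (N z).
- have m1 : 0 < N z by apply: lt_le_trans dm; rewrite divr_gt0.
  have ha := phi_power homega halpha hmono m1 (eqnorm_ge0 x).
  have hb := phi_power homega halpha hmono m1 (eqnorm_ge0 y).
  have ma0 : 0 < N z `^ alpha by rewrite powR_gt0.
  move: ha hb; set c := _ / (_ * _) => /(ler_wpM2l l0) ha.
  move=> /(ler_wpM2l (_ : 0 <= 1 - l)); rewrite subr_ge0 => /(_ l1) hb.
  have c0 : 0 <= c.
    by rewrite divr_ge0 ?(omega_ge0 homega)// mulr_ge0// ltW// addr_gt0.
  have := ler_wpM2l c0 (hsmooth x y l01); rewrite -/z -/d (power_succ halpha (ltW d0)).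
  move=> hs.
  suff key : c * (2 `^ (- alpha) * (d * d `^ alpha)) <= 2 * phi d.
    have := ler_wpM2l (mulr_ge0 ll0 (ltW hC)) key; lra.
  have hd0 : 0 < d / 2 by rewrite divr_gt0.
  have hp := omega_power homega hmono hd0 dm.
  have dE : 2 `^ (- alpha) * (d * d `^ alpha) = d * (d / 2) `^ alpha.
    have -> : d `^ alpha = (2 * (d / 2)) `^ alpha by congr (_ `^ _); field.
    rewrite powRM ?(ltW hd0)// powRN; field.
    by rewrite gt_eqF// powR_gt0.
  rewrite dE; apply: le_trans dphi.
  have -> : c * (d * (d / 2) `^ alpha)
      = d * (omega (N z) * (d / 2) `^ alpha / ((1 + alpha) * N z `^ alpha)).
    by rewrite /c; ring.
  rewrite ler_wpM2l ?(ltW d0)// ler_pdivrMr ?mulr_gt0// ?addr_gt0//.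
  apply: (le_trans hp); rewrite mulrA ler_wpM2r ?(ltW ma0)//.
  have w1 : omega (d / 2) <= omega d by apply: omega_le => //; [exact: ltW | lra].
  have w2 : 0 <= omega d * alpha by rewrite mulr_ge0 ?(omega_ge0 homega) ?ltW.
  by lra.
- have xz : N x <= N z + (1 - l) * d.
    have -> : x = z + (1 - l) *: (x - y).
      by rewrite /z -addrA -scalerDr (addrC y) subrK -scalerDl addrC subrK scale1r.
    by apply: le_trans (eqnormD _ _) _; rewrite eqnormZ ger0_norm ?subr_ge0//.
  have yz : N y <= N z + l * d.
    have -> : y = z - l *: (x - y).
      by rewrite /z scalerBr opprB addrC addrA subrK -scalerDl addrC subrK scale1r.
    by apply: le_trans (eqnormD _ _) _; rewrite eqnormN eqnormZ ger0_norm.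
  have a1 : 0 <= N z + (1 - l) * d by rewrite addr_ge0// mulr_ge0 ?subr_ge0// ltW.
  have b1 : 0 <= N z + l * d by rewrite addr_ge0// mulr_ge0// ltW.
  have := phi_le homega (eqnorm_ge0 x) xz; have := phi_le homega (eqnorm_ge0 y) yz.
  have := phi_tangent homega a1 m0; have := phi_tangent homega b1 m0.
  have h01 : 0 <= (2^-1 : R) <= 1 by lra.
  have := omega_concave homega a1 b1 h01.
  have -> : 2^-1 * (N z + (1 - l) * d) + (1 - 2^-1) * (N z + l * d)
      = N z + d / 2 by field.
  have : omega (N z + d / 2) <= omega d.
    by apply: omega_le => //; [rewrite addr_ge0// divr_ge0// ltW|lra].
  set wa := omega (_ + (1 - l) * d); set wb := omega (_ + l * d) => k1 k2 k3 k4.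
  move=> k5 k6.
  have k7 : phi (N y) <= phi (N z) + wb * (l * d) by lra.
  have k8 : phi (N x) <= phi (N z) + wa * ((1 - l) * d) by lra.
  have k9 : wa + wb <= 2 * omega d by lra.
  have j1 := ler_wpM2l l0 k8.
  have l1' : 0 <= 1 - l by rewrite subr_ge0.
  have j2 := ler_wpM2l l1' k7.
  have j3 := ler_wpM2l ll0 (ler_wpM2r (ltW d0) k9).
  have j4 := ler_wpM2l ll0 dphi.
  have j5 : l * (1 - l) * (4 * phi d) <= l * (1 - l) * (2 * C * phi d).
    by rewrite ler_wpM2l// ler_wpM2r//; lra.
  by lra.
Qed.

End PowerSmooth.
End Smoothness.
End EquivalentNorm.

(** * Extension of jets *)

Section Jets.
Variables (R : realType) (X : normedModType R) (N : X -> R).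
Hypothesis hN : equivalent_norm N.
Variables (omega : R -> R) (homega : modulus_of_continuity omega).
Local Notation phi := (phi omega).
Variable alpha : R.
Hypothesis halpha : 0 < alpha <= 1.
Hypothesis hmono : forall s t : R, 0 < s -> s <= t ->
  s `^ alpha / omega s <= t `^ alpha / omega t.
Variables (E : set X) (f : X -> R) (G : X -> dual_space X).

Lemma convex_comb_subr (x1 x2 y : X) (l : R) :
  l *: x1 + (1 - l) *: x2 - y = l *: (x1 - y) + (1 - l) *: (x2 - y).
Proof.
by rewrite !scalerBr addrACA -opprD -scalerDl [l + _]addrC subrK scale1r.
Qed.

(** The largest (or, for negative [M], the smallest) values that the Taylor bound
    [M * phi] at [y] allows to an extension of the jet. *)
Definition cone M y x : R := f y + G y (x - y) + M * phi (N (x - y)).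

(** With [m] the midpoint of [y] and [z], [h] the half difference and
    [v = x - m], Young's inequality absorbs the pairing of [v] with [G y - G z]
    at the cost of [2 M phi(N v)], the conjugate term being the one that the
    hypothesis provides. It remains to compare
    [phi(2 N h) + 2 phi(N v) <= 4 phi(N h) + 2 phi(N v)] with the cone terms: [N h]
    and [N v] are at most the mean of [N (v + h)] and [N (v - h)], so the factor
    [3] is enough by convexity of [phi]. *)
Lemma W1omega_cones M : 0 < M -> W1omega N omega E f G M ->
  forall z y x, E z -> E y -> cone (- (3 * M)) z x <= cone (3 * M) y x.
Proof.
move=> M0 hW z y x Ez Ey; rewrite /cone.
pose m := 2^-1 *: (y + z); pose h := 2^-1 *: (z - y); pose v := x - m.
have half (u : X) : 2^-1 *: (u + u) = u.
  by rewrite -(mulr2n u) -(scaler_nat 2 u) scalerA mulVf// scale1r.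
have xy : x - y = v + h.
  have {1}-> : y = m - h by rewrite -scalerBr opprB addrACA subrr addr0 half.
  by rewrite opprB addrA addrAC.
have xz : x - z = v - h.
  have {1}-> : z = m + h by rewrite -scalerDr (addrC y) addrACA subrr addr0 half.
  by rewrite opprD addrA.
have zy : z - y = 2 *: h by rewrite /h scalerA divff// scale1r.
have := hW y z Ey Ez.
set T := dnorm N (G y \- G z); rewrite zy.
have Gh S : dual_fun S (2 *: h) = 2 * dual_fun S h by rewrite linearZ.
have GD S : dual_fun S (v + h) = dual_fun S v + dual_fun S h by rewrite linearD.
have GB S : dual_fun S (v - h) = dual_fun S v - dual_fun S h by rewrite linearB.
rewrite xy xz !Gh GD GB.
have -> : N (y - z) = 2 * N h.
  by rewrite eqnorm_distC// zy eqnormZ// ger0_norm.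
have M20 : 0 < 2 * M by rewrite mulr_gt0.
have hT := dnorm_ge hN v (@dual_continuous _ _ (G y)) (@dual_continuous _ _ (G z)).
have := young homega (T / (2 * M)) (eqnorm_ge0 hN v).
rewrite -(ler_pM2l M20) mulrA (mulrC (2 * M)) divfK ?gt_eqF// => hY.
move: hT; rewrite -/T ler_norml => /andP[hT _].
have N1 := eqnorm_ge0 hN (v + h); have N2 := eqnorm_ge0 hN (v - h).
pose s := (N (v + h) + N (v - h)) / 2.
have hs : N h <= s.
  have := eqnormD hN (v + h) (- (v - h)).
  rewrite {1}opprB {1}(addrC v) addrACA subrr addr0 -(mulr2n h) -(scaler_nat 2 h).
  by rewrite eqnormZ// normr_nat eqnormN// /s; lra.
have vs : N v <= s.
  have := eqnormD hN (v + h) (v - h).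
  rewrite addrACA subrr addr0 -mulr2n -(scaler_nat 2 v) eqnormZ// normr_nat /s; lra.
have p1 := phi_midpoint homega N1 N2; rewrite -/s in p1.
have p2 := phi_double homega halpha hmono (eqnorm_ge0 hN h).
have p3 := phi_le homega (eqnorm_ge0 hN h) hs.
have p4 := phi_le homega (eqnorm_ge0 hN v) vs.
have key : phi (2 * N h) + 2 * phi (N v) <= 3 * (phi (N (v + h)) + phi (N (v - h))).
  by lra.
have := ler_wpM2l (ltW M0) key.
by lra.
Qed.

Section Extension.
Variable C : R.
Hypothesis hC : 0 < C.
Hypothesis hsmooth : forall (x y : X) (l : R), 0 <= l <= 1 ->
  l * N x `^ (1 + alpha) + (1 - l) * N y `^ (1 + alpha)
    - N (l *: x + (1 - l) *: y) `^ (1 + alpha)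
  <= l * (1 - l) * 2 `^ (- alpha) * C * N (x - y) `^ (1 + alpha).

(** The affine part of a cone cancels in its convexity defect. *)
Lemma cone_convexity_defect y M x1 x2 l : let z := l *: x1 + (1 - l) *: x2 in
  l * cone M y x1 + (1 - l) * cone M y x2 - cone M y z =
  M * (l * phi (N (x1 - y)) + (1 - l) * phi (N (x2 - y)) - phi (N (z - y))).
Proof.
move=> z; rewrite /cone /z.
rewrite convex_comb_subr.
have GD (S : dual_space X) a b u v : S (a *: u + b *: v) = a * S u + b * S v.
  by rewrite linearD !linearZ.
rewrite GD; ring.
Qed.

Lemma cone_para y M : 0 <= M ->
  paraconcave (fun v => 2 * C * M * phi (N v)) (cone M y) /\
  paraconvex (fun v => 2 * C * M * phi (N v)) (cone (- M) y).
Proof.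
move=> M0.
have key x1 x2 l : 0 <= l <= 1 ->
    M * (l * phi (N (x1 - y)) + (1 - l) * phi (N (x2 - y))
         - phi (N (l *: x1 + (1 - l) *: x2 - y)))
    <= l * (1 - l) * (2 * C * M * phi (N (x1 - x2))).
  move=> l01.
  have := phiN_paraconcave hN homega halpha hC hsmooth hmono (x1 - y) (x2 - y) l01.
  have -> : x1 - y - (x2 - y) = x1 - x2 by rewrite opprB addrA subrK.
  by rewrite -convex_comb_subr -lerBlDl => /(ler_wpM2l M0); lra.
split=> x1 x2 l l01; have := key x1 x2 l l01.
  by rewrite -cone_convexity_defect; lra.
by have := cone_convexity_defect y (- M) x1 x2 l; rewrite /= mulNr; lra.
Qed.

(** The sandwich function between the cones. On [E] the two cones at a point of
    [E] touch, which fixes the value and the derivative there. *)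
Theorem jet_extension M : E !=set0 -> 0 < M -> W1omega N omega E f G M ->
  exists F : X -> R^o, [/\ forall x, differentiable F x,
    extends_jet E f G F &
    forall x y, dnorm N ('d F x \- 'd F y) <= 24 * C * M * omega (N (x - y))].
Proof.
move=> E0 M0 hW; have M30 : 0 <= 3 * M by rewrite mulr_ge0// ltW.
pose A := 2 * C * (3 * M).
have A0 : 0 <= A by rewrite /A mulr_ge0// mulr_ge0// ltW.
have [F [Fvex Fcave LFU]] := paraconvex_sandwich E0
  (fun y _ => (cone_para y M30).2) (fun y _ => (cone_para y M30).1)
  (fun z y x Ez Ey => W1omega_cones M0 hW x Ez Ey).
have Psi0 v : 0 <= A * phi (N v) by rewrite mulr_ge0// phiN_ge0.
have Psi_small v e : 0 < e -> \forall t \near 0^'+, A * phi (N (t *: v)) <= e * t.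
  move=> e0; have c0 : 0 < A * N v + 1 by rewrite ltr_wpDl// mulr_ge0// eqnorm_ge0.
  have e'0 : 0 < e / (A * N v + 1) by rewrite divr_gt0.
  have [d d0 hd] := phiN_small hN homega e'0.
  have n0 : 0 < N v + 1 by rewrite ltr_wpDl// eqnorm_ge0.
  near=> t.
  have t0 : 0 < t by near: t; exact: nbhs_right_gt.
  have td : t <= d / (N v + 1).
    by near: t; apply: nbhs_right_le; rewrite divr_gt0.
  have Nt : N (t *: v) = t * N v by rewrite eqnormZ// gtr0_norm.
  have : N (t *: v) <= d.
    move: td; rewrite Nt ler_pdivlMr//; lra.
  move=> /hd /(ler_wpM2l A0) /le_trans; apply; rewrite Nt.
  have -> : A * (e / (A * N v + 1) * (t * N v)) = e * t * (A * N v / (A * N v + 1)).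
    by field; rewrite gt_eqF.
  apply: ler_piMr; first by rewrite mulr_ge0// ltW.
  by rewrite ler_pdivrMr// mul1r lerDl.
have Fd x : differentiable (F : X -> R^o) x /\
    forall v, `|F (x + v) - F x - 'd (F : X -> R^o) x v| <= A * phi (N v).
  have [T hT] := para_tangent_map Psi0 Psi_small Fvex Fcave x.
  suff Tc : continuous T.
    have [dF dE] := differentiable_taylor hN homega A0 Tc hT.
    by split=> // v; rewrite dE.
  (* The two cones at one point of E bound F, hence the tangent map, on balls. *)
  apply: bounded_linear_continuous; apply/bounded_funP => r.
  case: E0 => y Ey.
  have [k k0 hk] := continuous_linear_bound (@dual_continuous _ _ (G y)).
  have [c c0 hc] := eqnorm_le hN.
  pose s := `|x - y| + r.
  exists (`|f y| + k * s + 3 * M * phi (c * s) + `|F x| + A * phi (c * s)) => v vr.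
  have xv : `|x + v - y| <= s by rewrite addrAC (le_trans (ler_normD _ _))// lerD2l.
  have vs : `|v| <= s by rewrite (le_trans vr)// lerDr.
  have p w : `|w| <= s -> phi (N w) <= phi (c * s).
    move=> ws; apply: (phi_le homega (eqnorm_ge0 hN w)).
    by rewrite (le_trans (hc w))// ler_wpM2l// ltW.
  have p1 := ler_wpM2l A0 (p _ vs).
  have p2 := ler_wpM2l M30 (p _ xv).
  have := le_trans (hk (x + v - y)) (ler_wpM2l k0 xv).
  have := hT v; have /andP[] := LFU y Ey (x + v); rewrite /cone.
  have := ler_norm (f y); have := ler_norm (- f y).
  have := ler_norm (F x); have := ler_norm (- F x); rewrite !normrN.
  rewrite !ler_norml => ? ? ? ? ? ? /andP[? ?] /andP[? ?].
  by apply/andP; split; lra.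
exists F; split=> [x|y Ey|x y]; first by case: (Fd x).
  have Fy : F y = f y.
    have := LFU y Ey y; rewrite /cone subrr linear0 (eqnorm0 hN) phi0 !mulr0 !addr0.
    by rewrite -eq_le => /eqP.
  split=> //.
  have hG v : `|F (y + v) - F y - G y v| <= 3 * M * phi (N v).
    have := LFU y Ey (y + v); rewrite /cone (addrC y v) addrK Fy ler_norml.
    by move=> /andP[? ?]; apply/andP; split; lra.
  by have [_ ->] := differentiable_taylor hN homega M30 (@dual_continuous _ _ (G y)) hG.
have := taylor_lipschitz hN homega A0 (fun x => (Fd x).2) x y.
by have -> : 24 * C * M = 4 * A by rewrite /A; ring.
Unshelve. all: by end_near. Qed.

End Extension.

Lemma segment_is_derive (F : X -> R^o) y w (t : R) : differentiable F (y + t *: w) ->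
  is_derive t 1 (fun s : R => F (y + s *: w) : R) ('d F (y + t *: w) w).
Proof.
move=> dF; have h := deriveE w dF; have d := diff_derivable (v := w) dF.
have e : (fun h : R => h^-1 *: (((fun s : R => F (y + s *: w)) \o shift t) (h *: 1)
            - F (y + t *: w)))
    = (fun h => h^-1 *: ((F \o shift (y + t *: w)) (h *: w) - F (y + t *: w))).
  apply/funext => k /=; congr (_ *: (F _ - _)).
  by rewrite [k *: 1]mulr1 scalerDl addrCA.
by split; rewrite /derivable/derive e.
Qed.

(** By the mean value theorem [F z - F y] is within [2 K phi(d)], [d = N (z - y)],
    of each of the two linear predictions, hence above their mean by no more. The
    conjugate term is small as well: its argument is at most [omega d / 8], and
    the tangent of [phi] at [d] bounds [phi_star] there by [phi d / 4]. *)
Lemma W1omega_necessary K (F : X -> R^o) : 0 < K ->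
  (forall x, differentiable F x) ->
  (forall x y, dnorm N ('d F x \- 'd F y) <= K * omega (N (x - y))) ->
  extends_jet E f G F -> W1omega N omega E f G (4 * K).
Proof.
move=> K0 dF hK FE y z Ey Ez.
have [<- dy] := FE y Ey; have [<- dz] := FE z Ez.
have -> : (G y \- G z) = ('d F y \- 'd F z) by apply/funext => v /=; rewrite dy dz.
rewrite -dy -dz; set w := z - y.
have -> : N (y - z) = N w by rewrite eqnorm_distC.
have d0 := eqnorm_ge0 hN w.
have d2 := omega_le_phi homega halpha hmono d0.
have taylor1 p (t : R) : 0 <= t <= 1 -> N (y + t *: w - p) <= N w ->
    'd F (y + t *: w) w <= 'd F p w + 2 * K * phi (N w).
  move=> t01 tp; set q := y + _.
  have := dnorm_ge hN w (diff_continuous (dF q)) (diff_continuous (dF p)).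
  have := ler_wpM2r d0 (hK q p).
  have := omega_le homega (eqnorm_ge0 hN _) tp.
  move=> /(ler_wpM2l (ltW K0)) /(ler_wpM2r d0) h1 h2.
  have := ler_wpM2l (ltW K0) d2 => h3 /(le_trans (ler_norm _)); lra.
have gd (t : R) : t \in `]0, 1[ ->
    is_derive t 1 (fun s : R => F (y + s *: w) : R) ('d F (y + t *: w) w).
  by move=> _; exact: segment_is_derive.
have gc : {within `[0, 1], continuous (fun s : R => F (y + s *: w) : R)}.
  apply: derivable_within_continuous => t _.
  by have := segment_is_derive (dF (y + t *: w)) => -[].
have [t] := MVT ltr01 gd gc.
rewrite in_itv/= scale1r scale0r addr0 /w subrKC -/w subr0 mulr1 => /andP[t0 t1] FE1.
have t01 : 0 <= t <= 1 by rewrite !ltW.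
have ty : N (y + t *: w - y) <= N w.
  by rewrite addrAC subrr add0r eqnormZ// gtr0_norm// ler_piMl// ltW.
have tz : N (y + t *: w - z) <= N w.
  have -> : y + t *: w - z = - ((1 - t) *: w).
    by rewrite (addrC y) -addrA scalerBl scale1r opprB /w opprB.
  have t1' : 0 <= 1 - t by rewrite subr_ge0 ltW.
  by rewrite eqnormN// eqnormZ// ger0_norm// ler_piMl// gerBl ltW.
have h1 := taylor1 y t t01 ty; have h2 := taylor1 z t t01 tz.
set T := dnorm N _.
have hT : T <= K * omega (N w).
  by have := hK y z; rewrite -/T eqnorm_distC.
have star : 2 * (4 * K) * phi_star omega (T / (2 * (4 * K))) <= 2 * K * phi (N w).
  have K8 : 0 < 2 * (4 * K) by lra.
  rewrite -ler_pdivlMl//; apply: phi_star_le => s s0.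
  have := phi_tangent homega d0 s0.
  have p0 := phi_ge0 homega s0; have q0 := phi_ge0 homega d0.
  have : T / (2 * (4 * K)) * s <= 8^-1 * omega (N w) * s.
    rewrite ler_wpM2r// ler_pdivrMr//.
    by have -> : 8^-1 * omega (N w) * (2 * (4 * K)) = K * omega (N w) by field.
  have -> : (2 * (4 * K))^-1 * (2 * K * phi (N w)) = 4^-1 * phi (N w).
    by field; rewrite gt_eqF.
  by lra.
have := phi_ge0 homega d0 => /(ler_wpM2l (ltW K0)) p0.
lra.
Qed.

End Jets.

(** * The extension theorem *)

Lemma two_le_three_power (R : realType) (alpha : R) : 0 < alpha <= 1 ->
  2 <= 3 `^ (1 + alpha) / (1 + alpha).
Proof.
move=> halpha; case/andP: (halpha) => al0 al1.
rewrite ler_pdivlMr ?addr_gt0// (power_succ halpha)//.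
have [h|h] := leP alpha 2^-1.
  have : 3 `^ 0 <= 3 `^ alpha :> R by rewrite ler_powR ?ler1n// ltW.
  by rewrite powRr0; lra.
have : 3 `^ 2^-1 <= 3 `^ alpha :> R by rewrite ler_powR ?ler1n// ltW.
have : 4 / 3 <= 3 `^ 2^-1 :> R.
  rewrite powR12_sqrt// -[leLHS]gtr0_norm ?divr_gt0// -sqrtr_sqr ler_sqrt//; lra.
by lra.
Qed.

(* Only the values of [f] and [G] on [E] are relevant. *)
Theorem theorem1p10 (R : realType) (alpha C : R)
    (halpha : 0 < alpha <= 1) (hC : 0 < C)
    (X : completeNormedModType R) (hX : superreflexive X)
    (N : X -> R) (hN : equivalent_norm N)
    (hsmooth : forall (x y : X) (l : R), 0 <= l <= 1 ->
       l * N x `^ (1 + alpha) + (1 - l) * N y `^ (1 + alpha)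
         - N (l *: x + (1 - l) *: y) `^ (1 + alpha)
       <= l * (1 - l) * 2 `^ (- alpha) * C * N (x - y) `^ (1 + alpha))
    (omega : R -> R) (homega : modulus_of_continuity omega)
    (hmono : forall s t : R, 0 < s -> s <= t ->
       s `^ alpha / omega s <= t `^ alpha / omega t)
    (E : set X) (hE : E !=set0) (f : X -> R) (G : X -> dual_space X) :
  ((exists F : X -> R^o, C1omega N omega F /\ extends_jet E f G F) <->
   (exists M : R, 0 < M /\ W1omega N omega E f G M)) /\
  (forall M : R, 0 < M -> W1omega N omega E f G M ->
     exists F : X -> R^o,
       [/\ C1omega N omega F, extends_jet E f G F &
           (Momega N omega F
            <= (12 * (1 + 3 `^ (1 + alpha) / (1 + alpha) * C) * M)%:E)%E]).
Proof.
have al0 : 0 < alpha by case/andP: halpha.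
have exists_extension M : 0 < M -> W1omega N omega E f G M ->
    exists F : X -> R^o, [/\ C1omega N omega F, extends_jet E f G F &
      (Momega N omega F
       <= (12 * (1 + 3 `^ (1 + alpha) / (1 + alpha) * C) * M)%:E)%E].
  move=> M0 hW.
  have [F [dF FE hF]] := jet_extension hN homega halpha hmono hC hsmooth hE M0 hW.
  exists F; split=> //.
    by split=> //; exists (24 * C * M); split=> //; rewrite !mulr_gt0.
  apply: ge_ereal_sup => _ [[x y] /= xy <-]; rewrite lee_fin.
  have Nxy : 0 < N (x - y) by apply: (eqnorm_gt0 hN); rewrite subr_eq0.
  rewrite ler_pdivrMr ?(omega_gt0 homega)//; apply: (le_trans (hF x y)).
  apply: ler_wpM2r; first by rewrite ltW// (omega_gt0 homega).
  have := two_le_three_power halpha => /(ler_wpM2r (ltW hC)) /(ler_wpM2r (ltW M0)).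
  by have := M0; lra.
split=> //; split=> [[F [[dF [K [K0 hK]]] FE]]|[M [M0 hW]]].
  exists (4 * K); split; first by rewrite mulr_gt0.
  exact: (W1omega_necessary hN homega halpha hmono K0 dF hK FE).
by have [F [F1 F2 _]] := exists_extension M M0 hW; exists F.
Qed.
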